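(* Let $X_1,\dots,X_n$ be i.i.d. real random variables with well-defined mean $\mu=\mathbb{E}X_1$, and for $p\geq1$ let $\nu_p:=(\mathbb{E}|X_1-\mu|^p)^{1/p}$. Let $\epsilon\in(0,1/2)$ and let $X_1^\epsilon,\dots,X_n^\epsilon$ be any random variables with $\#\{i\in[n]: X_i^\epsilon\neq X_i\}\leq\epsilon n$. Fix $0<\alpha<1$ and assume \[\left(\sqrt{2\lfloor\epsilon n\rfloor+2\lceil\log(4/\alpha)\rceil-1}+\sqrt{\lceil\log(4/\alpha)\rceil}\right)^2\leq dn\quad\text{for some }0<d<1.\] Let $k:=\lfloor\epsilon n\rfloor+\lceil\log(4/\alpha)\rceil$. Then \[\Pr\left(|\overline{X^\epsilon}_{n,k}-\mu|\leq C(d)\left(\inf_{p\geq1}\nu_p\,\epsilon^{\frac{p-1}{p}}+\inf_{1\leq q\leq2}\nu_q\left(\frac{\log(4/\alpha)}{n}\right)^{\frac{q-1}{q}}\right)\right)\geq1-\alpha,\] where $C(d)$ is a constant depending only on $d$.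
   Context: For $X^\epsilon_{(1)}\leq\dots\leq X^\epsilon_{(n)}$ the order statistics of $X_1^\epsilon,\dots,X_n^\epsilon$ and an integer $0\le k<n/2$, $\overline{X^\epsilon}_{n,k}:=\frac{1}{n-2k}\sum_{i=k+1}^{n-k}X^\epsilon_{(i)}$ is the trimmed mean of the contaminated sample. *)

(* Defs.v *)
From HB Require Import structures.
From mathcomp Require Import all_boot all_order all_algebra.
From mathcomp Require Import all_classical all_reals all_analysis.
Set Implicit Arguments. Unset Strict Implicit. Unset Printing Implicit Defensive.
Import Order.TTheory GRing.Theory Num.Theory.
Import numFieldNormedType.Exports.
Local Open Scope classical_set_scope.
Local Open Scope ring_scope.

Definition order_stats (R : realType) (n : nat) (x : 'I_n -> R) : seq R :=
  sort <=%R [seq x i | i <- enum 'I_n].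

(* k-trimmed mean: (1/(n-2k)) * sum_{i=k+1}^{n-k} x_(i)
   (0-based indices k .. n-k-1 of the sorted sequence). *)
Definition trimmed_mean (R : realType) (n k : nat) (x : 'I_n -> R) : R :=
  (n - 2 * k)%:R^-1 * \sum_(k <= i < n - k) nth 0 (order_stats x) i.

Definition mutually_independent d (T : measurableType d) (R : realType)
  (P : probability T R) (n : nat) (X : 'I_n -> {RV P >-> R}) : Prop :=
  forall (J : {set 'I_n}) (B : 'I_n -> set R),
    (forall i, measurable (B i)) ->
    P [set w | forall i, i \in J -> B i (X i w)] =
    (\prod_(i in J) P (X i @^-1` B i))%E.

(* Main.v *)
(** Write [Y = X - mu], let [f] and [c] be the two summands of [k], and fix
  finite [p >= 1], [1 <= q <= 2].  Truncate at the levels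
  [b = nu_q (c / 16n)^(-1/q)] and [M = nu_p eps^(-1/p)].  Chernoff bounds show
  that, outside an event of probability at most [4 exp (-c) <= alpha], fewer
  than [c] of the [|Y_i|] exceed [b], the sum of the [Y_i] clipped to [[-b, b]]
  is at most [2cb] in absolute value, and the total excess over [M] of the
  clipped [|Y_i|] is at most [cb + 3 n eps M].  On that event the values kept by
  the trimming lie in [[-b, b]], so their sum differs from the clipped sum only
  through [3f + 2c] removed values, each at most [min (M, b)] plus its excess,
  and at most [f] contaminated values that survive; the latter are dominated by
  genuine values trimmed on the same side.  Since [c b / n] and [eps M] are of
  the order of the two terms of the claim, this gives the bound for fixed [p]
  and [q]; the infima are reached by continuity of [P]. *)
Require Import Defs.
From HB Require Import structures.
From mathcomp Require Import all_boot all_order all_algebra.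
From mathcomp Require Import all_classical all_reals all_analysis.
From mathcomp Require Import perm measurable_realfun zify ring lra.
Set Implicit Arguments. Unset Strict Implicit. Unset Printing Implicit Defensive.
Import Order.TTheory GRing.Theory Num.Theory.
Import numFieldNormedType.Exports.
Local Open Scope classical_set_scope.
Local Open Scope ring_scope.

(** * Product expectations and an exponential tail bound for an i.i.d. sample *)

Section independence.
Context d (T : measurableType d) (R : realType) (P : probability T R).
Import HBNNSimple.
Local Open Scope ereal_scope.

(** A factorisation known for indicators extends to simple functions by linearity, and then to [f]
    by monotone convergence. In use, [G] is the product of the factors at the other coordinates and
    [K] its integral. *)
Lemma ge0_integral_indep (X : {RV P >-> R}) (law : probability R R)
    (G : T -> R) (K : R) (f : R -> R) :
  measurable_fun setT G -> (forall w, 0 <= G w)%R -> (0 <= K)%R ->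
  measurable_fun [set: R] f -> (forall x, 0 <= f x)%R ->
  (forall B, measurable B ->
    \int[P]_w (\1_B (X w) * G w)%:E = law B * K%:E) ->
  \int[P]_w (f (X w) * G w)%:E = (\int[law]_x (f x)%:E) * K%:E.
Proof.
move=> mG G0 K0 mf f0 H.
pose fE : R -> \bar R := EFin \o f.
have mfE : measurable_fun [set: R] fE by exact/measurable_EFinP.
have fE0 x : [set: R] x -> 0 <= fE x by rewrite lee_fin.
pose h := nnsfun_approx measurableT mfE.
have mhX n : measurable_fun setT (fun w => h n (X w)).
  exact: (measurableT_comp (measurable_funPT (h n))).
have -> : \int[law]_x (f x)%:E = limn (fun n => \int[law]_x (EFin \o h n) x).
  rewrite -monotone_convergence//; last 3 first.
  - by move=> n; exact/measurable_EFinP.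
  - by move=> n x _; rewrite lee_fin.
  - by move=> x _ a b ab; rewrite lee_fin; exact/lefP/nd_nnsfun_approx.
  apply: eq_integral => x _; apply/esym/cvg_lim => //.
  exact: (@cvg_nnsfun_approx _ _ _ _ measurableT fE).
have -> : \int[P]_w (f (X w) * G w)%:E =
    limn (fun n => \int[P]_w (h n (X w) * G w)%:E).
  rewrite -monotone_convergence//; last 3 first.
  - by move=> n; apply/measurable_EFinP; exact: measurable_funM.
  - by move=> n x _; rewrite lee_fin mulr_ge0.
  - move=> x _ a b ab; rewrite lee_fin ler_wpM2r//.
    exact/lefP/nd_nnsfun_approx.
  apply: eq_integral => x _; apply/esym/cvg_lim => //.
  rewrite EFinM.
  have hG : (G x)%:E \is a fin_num by [].
  apply: (cvgeZr hG (f := fun n => (h n (X x))%:E) (x := (f (X x))%:E)).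
  exact: (@cvg_nnsfun_approx _ _ _ _ measurableT fE).
have hlaw n : \int[P]_w (h n (X w) * G w)%:E
    = (\int[law]_x (EFin \o h n) x) * K%:E.
  rewrite integralT_nnsfun sintegralE.
  transitivity (\int[P]_w
     (\sum_(y \in range (h n)) (y%:E * (\1_(h n @^-1` [set y]) (X w) * G w)%:E))).
    apply: eq_integral => w _; rewrite EFinM {1}fimfunE -fsumEFin//.
    rewrite ge0_mule_fsuml; last by move=> y; exact: nnfun_muleindic_ge0.
    by apply: eq_fsbigr => y _; rewrite -!EFinM mulrA.
  have mi y : measurable_fun setT
      (fun w => (\1_(h n @^-1` [set y]) (X w) * G w)%:E).
    apply/measurable_EFinP; apply: measurable_funM => //.
    exact: measurableT_comp (measurable_indic _) _.
  have nn y w : 0 <= y%:E * (\1_(h n @^-1` [set y]) (X w) * G w)%:E.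
    rewrite -EFinM mulrA EFinM mule_ge0//; first exact: nnfun_muleindic_ge0.
    by rewrite lee_fin.
  rewrite ge0_integral_fsum//; last 1 first.
    by move=> y; apply: emeasurable_funM.
  rewrite ge0_mule_fsuml; last by move=> y; exact: nnsfun_mulemu_ge0.
  apply: eq_fsbigr => y; rewrite inE => -[x _ hxy].
  rewrite ge0_integralZl//; last 2 first.
  - by move=> w _; rewrite lee_fin mulr_ge0// indicE.
  - by rewrite lee_fin -hxy.
  by rewrite H ?muleA.
under [X in limn X = _]eq_fun do rewrite hlaw.
apply/cvg_lim => //; apply: cvgeZr => //.
apply: ereal_nondecreasing_is_cvgn => a b ab; apply: ge0_le_integral => //.
- by move=> x _; rewrite lee_fin.
- exact/measurable_EFinP.
- exact/measurable_EFinP.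
- by move=> x _; rewrite lee_fin; exact/lefP/nd_nnsfun_approx.
Qed.

Context (n : nat) (X : 'I_n -> {RV P >-> R}) (law : probability R R).
Hypotheses (indX : mutually_independent X)
  (lawX : forall i (A : set R), measurable A -> distribution P (X i) A = law A).

(** Independence speaks of events only, so the coordinates pass one at a time from an indicator to
    [g], by induction on [m]. The case [m = 0] is independence for the full index set. *)
Lemma integral_prod_indep_indic (g : R -> R) (c : R) (m : nat)
    (B : 'I_n -> set R) :
  measurable_fun [set: R] g -> (forall x, 0 <= g x)%R ->
  \int[law]_x (g x)%:E = c%:E -> (m <= n)%N -> (forall i, measurable (B i)) ->
  \int[P]_w (\prod_(i < n) (if (i < m)%N then g (X i w) else \1_(B i) (X i w)))%:E =
  (\prod_(i < n) (if (i < m)%N then c else fine (law (B i))))%:E.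
Proof.
move=> mg g0 gc; have c0 : (0 <= c)%R.
  by rewrite -lee_fin -gc integral_ge0// => x _; rewrite lee_fin.
elim: m B => [|m IH] B mn mB.
  rewrite [in RHS](eq_bigr (fun i => fine (law (B i))))//.
  have -> : (fun w => (\prod_(i < n) (if (i < 0)%N then g (X i w)
      else \1_(B i) (X i w)))%:E) =
      (fun w => (\1_[set w | forall i, i \in [set: 'I_n]%SET -> B i (X i w)] w)%:E).
    apply/funext => w; congr EFin; rewrite indicE.
    have [|] := boolP (w \in _).
      rewrite inE/= => h; rewrite big1// => i _.
      by rewrite indicE mem_set//; apply: h; rewrite inE.
    move=> /negP h; apply/eqP/prodf_eq0.
    have [i hi] : exists i, ~ B i (X i w).
      by apply/existsNP => hB; apply: h; rewrite inE.
    by exists i => //; rewrite indicE memNset.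
  rewrite integral_indic//; last first.
    rewrite (_ : mkset _ = \bigcap_(i in [set: 'I_n]) (X i @^-1` B i)); last first.
      by apply/seteqP; split => [w h i _|w h i _]; [apply: h; rewrite inE|exact: h].
    apply: fin_bigcap_measurable => // i _.
    by rewrite -[X in measurable X]setTI; exact: measurable_funPT.
  rewrite setIT.
  transitivity (\prod_(i in [set: 'I_n]%SET) P (X i @^-1` B i)).
    exact: indX.
  rewrite -prodEFin; apply: eq_big => [i|i _]; first by rewrite finset.in_setT.
  by rewrite -(lawX i (mB i)) fineK//; exact: fin_num_measure.
pose j : 'I_n := Ordinal mn.
rewrite (bigD1 j)//= ltnSn.
pose G w := (\prod_(i < n | i != j)
  (if (i < m)%N then g (X i w) else \1_(B i) (X i w)))%R.
pose K := (\prod_(i < n | i != j)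
  (if (i < m)%N then c else fine (law (B i))))%R.
have jm i : i != j -> (i < m.+1)%N = (i < m)%N.
  by move=> ij; rewrite ltnS leq_eqVlt -(inj_eq val_inj)/= in ij *;
     rewrite (negbTE ij).
transitivity (\int[P]_w (g (X j w) * G w)%:E).
  apply: eq_integral => w _; rewrite (bigD1 j)//= ltnSn; congr (_ * _)%:E.
  by apply: eq_bigr => i /jm ->.
rewrite (eq_bigr (fun i : 'I_n => if (i < m)%N then c else fine (law (B i))));
  last by move=> i /jm ->.
rewrite EFinM -gc; apply: ge0_integral_indep => //.
- rewrite /G (_ : (fun w => _) = (fun w => \prod_(i <- [seq i <- index_enum 'I_n | i != j])
      (if (i < m)%N then g (X i w) else \1_(B i) (X i w))))%R; last first.
    by apply/funext => w; rewrite big_filter.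
  apply: measurable_prod => i _; case: (i < m)%N.
    exact: measurableT_comp.
  by apply: measurableT_comp => //; exact: measurable_indic.
- by move=> w; apply: prodr_ge0 => i _; case: ifP => // _; rewrite indicE.
- by apply: prodr_ge0 => i _; case: ifP => // _; exact: fine_ge0.
(* The indicator at [j] is still free in the induction hypothesis; putting [B'] there gives the
   factorisation for every event at [j]. *)
move=> B' mB'.
have := IH (fun i => if i == j then B' else B i) (ltnW mn).
rewrite (bigD1 j)//= ltnn eqxx EFinM fineK//; last exact: fin_num_measure.
under eq_integral do rewrite (bigD1 j)//= ltnn eqxx.
move=> IHj; transitivity (law B' * (\prod_(i < n | i != j)
   (if (i < m)%N then c else fine (law (if i == j then B' else B i))))%:E).
  rewrite -IHj; last by move=> i; case: ifP.
  apply: eq_integral => w _; congr (_ * _)%:E.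
  by apply: eq_bigr => i /negbTE ->.
by congr (_ * _%:E); apply: eq_bigr => i /negbTE ->.
Qed.

Lemma integral_prod_iid (g : R -> R) (c : R) :
  measurable_fun [set: R] g -> (forall x, 0 <= g x)%R ->
  \int[law]_x (g x)%:E = c%:E ->
  \int[P]_w (\prod_(i < n) g (X i w))%:E = (c ^+ n)%:E.
Proof.
move=> mg g0 gc.
have := integral_prod_indep_indic mg g0 gc (leqnn n) (fun=> measurableT).
under eq_integral do under eq_bigr do rewrite ltn_ord.
by under [in RHS]eq_bigr do rewrite ltn_ord; rewrite prodr_const card_ord.
Qed.

(** Markov's inequality for the exponential of the sum, followed by [(1 + a) ^+ n <= expR (n * a)].
    The usual scale parameter is absorbed into [g]. *)
Lemma chernoff_iid (g : R -> R) (a t : R) : measurable_fun [set: R] g ->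
  \int[law]_x (expR (g x))%:E <= (1 + a)%:E ->
  P [set w | t <= \sum_(i < n) g (X i w)]%R <= (expR (n%:R * a - t))%:E.
Proof.
move=> mg ha.
have mS : measurable_fun setT (fun w => \sum_(i < n) g (X i w))%R.
  apply: measurable_sum => i; exact: measurableT_comp.
have meg : measurable_fun [set: R] (expR \o g).
  exact: measurableT_comp.
have int0 : 0 <= \int[law]_x (expR (g x))%:E.
  by apply: integral_ge0 => x _; rewrite lee_fin expR_ge0.
have [c gc] : exists c, \int[law]_x (expR (g x))%:E = c%:E.
  exists (fine (\int[law]_x (expR (g x))%:E)); rewrite fineK//.
  by rewrite ge0_fin_numE// (le_lt_trans ha)// ltry.
rewrite gc !lee_fin in ha int0.
have mA : measurable [set w | t <= \sum_(i < n) g (X i w)]%R.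
  rewrite -[X in measurable X]setTI; exact: measurable_fun_ler.
rewrite -[P _]/(P _) -[X in P X]setIT -integral_indic//.
apply: (@le_trans _ _ (\int[P]_w ((expR (- t))%:E * (\prod_(i < n) expR (g (X i w)))%:E))).
  apply: ge0_le_integral => //.
  - by apply/measurable_EFinP; exact: measurable_indic.
  - apply: emeasurable_funM => //; apply/measurable_EFinP.
    by apply: measurable_prod => i _; exact: measurableT_comp meg _.
  - move=> w _; rewrite -EFinM lee_fin -expR_sum -expRD indicE.
    have [|_] := boolP (w \in _); last by rewrite expR_ge0.
    by rewrite inE/= => h; rewrite -expR0 ler_expR addrC subr_ge0.
rewrite ge0_integralZl_EFin ?expR_ge0//; last 2 first.
- by move=> w _; rewrite lee_fin; apply: prodr_ge0 => i _; exact: expR_ge0.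
- apply/measurable_EFinP.
  by apply: measurable_prod => i _; exact: measurableT_comp meg _.
rewrite (@integral_prod_iid _ c meg)//; last by move=> x; exact: expR_ge0.
rewrite -EFinM lee_fin addrC expRD ler_pM2l ?expR_gt0// expRM_natl.
rewrite lerXn2r ?nnegrE ?expR_ge0//.
by rewrite (le_trans ha)// expR_ge1Dx.
Qed.

End independence.

(** * Truncation and pointwise exponential inequalities *)

Section pointwise.
Context (R : realType).
Implicit Types (u y b M p q : R).

Definition clip b y : R := Num.max (- b) (Num.min y b).
(** For [0 <= b] this is the positive part of [|clip b y| - M]; with [0 <= M] it is at most [b],
    which controls its exponential moments. *)
Definition excess b M y : R := Num.max 0 (Num.min `|y| b - M).

Lemma clip_norm_le b y : 0 <= b -> `|clip b y| <= b.
Proof.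
move=> b0; rewrite /clip ler_norml le_max lexx/= ge_max ge_min lexx orbT andbT.
by lra.
Qed.

Lemma clip_id b y : `|y| <= b -> clip b y = y.
Proof. by rewrite ler_norml /clip => /andP[? ?]; rewrite min_l// max_r. Qed.

Lemma clipN b y : 0 <= b -> clip b (- y) = - clip b y.
Proof.
move=> b0; rewrite /clip; case: (lerP (- y) b) => ?; case: (lerP y b) => ?.
- by rewrite max_r ?max_r//; lra.
- by rewrite max_l ?max_r; lra.
- by rewrite max_r ?max_l; lra.
- by lra.
Qed.

Lemma clip_le_excess b M y : 0 <= b -> 0 <= M ->
  `|clip b y| <= Num.min M b + excess b M y.
Proof.
move=> b0 M0; have : `|clip b y| <= Num.min `|y| b.
  rewrite le_min clip_norm_le// andbT.
  have [/clip_id->//|yb] := leP `|y| b.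
  by rewrite (le_trans (clip_norm_le _ b0))// ltW.
move/le_trans; apply; rewrite /excess.
case: (lerP M b) => ?; case: (lerP `|y| b) => ?; case: (lerP 0 _) => ?; lra.
Qed.

Lemma excess_ge0 b M y : 0 <= excess b M y.
Proof. by rewrite /excess le_max lexx. Qed.

(** Square and invert [1 - u / 2 <= expR (- u / 2)]. Exponential inequalities with explicit
    constants thereby become polynomial ones. *)
Lemma expR_le_inv_sqr u : u < 2 -> expR u <= ((1 - u / 2) ^+ 2)^-1.
Proof.
move=> u2; have h : 0 < 1 - u / 2 by lra.
rewrite -[expR u]invrK -expRN lef_pV2 ?posrE ?exprn_gt0 ?expR_gt0//.
have -> : - u = - (u / 2) + - (u / 2) by lra.
rewrite expRD -expr2 lerXn2r ?nnegrE ?expR_ge0//; first exact: ltW.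
exact: expR_ge1Dx.
Qed.

Lemma expR_le_of_mul u y : u < 2 -> 1 <= y * (1 - u / 2) ^+ 2 -> expR u <= y.
Proof.
move=> u2 h; apply: le_trans (expR_le_inv_sqr u2) _.
by rewrite -div1r ler_pdivrMr// exprn_gt0//; lra.
Qed.

Lemma expR1_le4 : expR 1 <= 4 :> R.
Proof. by apply: expR_le_of_mul; [lra|nra]. Qed.

Lemma powR_ge_id u p : 1 <= u -> 1 <= p -> u <= u `^ p.
Proof. by move=> u1 p1; rewrite -[leLHS]powRr1 ?ler_powR//; lra. Qed.

Lemma powR_ge_sqr u q : 0 <= u <= 1 -> 1 <= q <= 2 -> u ^+ 2 <= u `^ q.
Proof.
move=> /andP[u0 u1] /andP[q1 q2].
have [->|u_neq0] := eqVneq u 0; first by rewrite expr0n powR_ge0.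
have u_gt0 : 0 < u by rewrite lt_neqAle eq_sym u_neq0.
by rewrite -powR_mulrn// ger_powR// u_gt0.
Qed.

(** Put [u = y / b]. For [|u| <= 1] the remainder [8 * u ^+ 2] is absorbed since [q <= 2]; for
    [|u| > 1] the left side is at most [expR 1 <= 4] and [|u|] is at most its power of order [q].
    The linear term is kept because it vanishes under the centred law. *)
Lemma expR_clip_le b q y : 0 < b -> 1 <= q <= 2 ->
  expR (clip b y / b) <= 1 + y / b + 8 * `|y / b| `^ q.
Proof.
move=> b0 q12; have /andP[q1 q2] := q12.
have -> : clip b y / b = clip 1 (y / b).
  rewrite /clip maxr_pMl ?minr_pMl ?invr_ge0 ?(ltW b0)//.
  by rewrite mulNr divff ?gt_eqF.
set u := y / b; have [u1|u1] := leP `|u| 1.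
  rewrite clip_id//; have : u ^+ 2 <= `|u| `^ q.
    by rewrite -real_normK ?num_real// powR_ge_sqr// normr_ge0.
  move: u1; rewrite ler_norml => /andP[? ?] ?; apply: expR_le_of_mul; first lra.
  apply: (@le_trans _ _ ((1 + u + 8 * u ^+ 2) * (1 - u / 2) ^+ 2)).
    (* This quantity is [(1 + u + 8 * u ^+ 2) * (1 - u / 2) ^+ 2 - 1]. *)
    have : 0 <= u ^+ 2 * (29 / 4 - 31 / 4 * u + 2 * u ^+ 2).
      by rewrite mulr_ge0 ?sqr_ge0//; nra.
    by nra.
  by apply: ler_wpM2r; [exact: sqr_ge0|lra].
have uq : `|u| <= `|u| `^ q by apply: powR_ge_id => //; exact: ltW.
have e4 := expR1_le4.
have [u0|u0] := ger0P u; last first.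
  rewrite (ltr0_norm u0) in u1 uq *.
  rewrite /clip min_l ?max_l; try lra.
  by apply: (@le_trans _ _ (expR 0)); rewrite ?ler_expR ?expR0; lra.
rewrite (ger0_norm u0) in u1 uq *.
by rewrite /clip min_r ?max_r; lra.
Qed.

(** The constant [15] comes from [expR 2 <= 16]. The factor [2] turns a count of [c] exceedances
    into the threshold [2 * c]. *)
Lemma expR_exceed_le b q y : 0 < b -> 1 <= q ->
  expR (2 * (b < `|y|)%R%:R) <= 1 + 15 * `|y / b| `^ q.
Proof.
move=> b0 q1; have [yb|_] := ltP b `|y|; last first.
  by rewrite mulr0 expR0; have := powR_ge0 `|y / b| q; lra.
have u1 : 1 <= `|y / b|.
  by rewrite normrM normfV (gtr0_norm b0) ler_pdivlMr// mul1r ltW.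
rewrite mulr1 -[2]/(1 + 1) expRD.
have := powR_ge_id u1 q1; have := expR1_le4; have := expR_gt0 (1 : R); nra.
Qed.

(** The ratio [x = excess b M y / b] lies in [[0, 1]], where [expR x <= 1 + 3 * x]; and the excess,
    zero when [|y| <= M], is at most [M] times the power of [|y / M|]. *)
Lemma expR_excess_le b M p y : 0 < b -> 0 < M -> 1 <= p ->
  expR (excess b M y / b) <= 1 + 3 * (M / b) * `|y / M| `^ p.
Proof.
move=> b0 M0 p1; set e := excess b M y; have e0 : 0 <= e := excess_ge0 _ _ _.
have eb : e / b <= 1.
  rewrite ler_pdivrMr// mul1r /e /excess ge_max (ltW b0)/=.
  by case: (lerP `|y| b) => ?; lra.
apply: (@le_trans _ _ (1 + 3 * (e / b))).
  have : 0 <= e / b by rewrite divr_ge0// ltW.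
  move: (e / b) eb => x x1 x0; apply: expR_le_of_mul; first lra.
  (* The product is four times [(1 + 3 * x) * (1 - x / 2) ^+ 2 - 1]. *)
  have : 0 <= x * ((1 - x) * (8 - 3 * x)) by rewrite !mulr_ge0//; lra.
  by nra.
rewrite lerD2l -mulrA ler_pM2l// mulrAC ler_pM2r ?invr_gt0//.
rewrite /e /excess ge_max mulr_ge0 ?powR_ge0 ?(ltW M0)//=.
have [yM|yM] := leP M `|y|.
  have u1 : 1 <= `|y / M| by rewrite normrM normfV (gtr0_norm M0) ler_pdivlMr// mul1r.
  apply: (@le_trans _ _ `|y|); first by case: (lerP `|y| b) => ?; lra.
  rewrite -ler_pdivrMl// mulrC (le_trans _ (powR_ge_id u1 p1))//.
  by rewrite normrM normfV (gtr0_norm M0).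
apply: (@le_trans _ _ 0); last by rewrite mulr_ge0 ?powR_ge0 ?(ltW M0).
by case: (lerP `|y| b) => ?; lra.
Qed.

End pointwise.

(** * From pointwise bounds to exponential moments of the centred law *)

Section moments.
Context (R : realType) (law : probability R R).
Hypothesis law1 : law.-integrable [set: R] EFin.
Let mu : R := fine (\int[law]_x (x%:E))%E.

Lemma measurable_powR_dist (c p : R) :
  measurable_fun [set: R] (fun x => `|x - c| `^ p).
Proof.
apply: (measurableT_comp (measurable_powR p)).
by apply: (measurableT_comp (@normr_measurable _ _)); exact: measurable_funB.
Qed.

Lemma integral_affine (a : R) :
  (\int[law]_x (1 + a * (x - mu))%:E = 1)%E.
Proof.
have fmu : ((\int[law]_x x%:E)%E \is a fin_num) by exact: integrable_fin_num law1.
have i1 (c : R) : law.-integrable [set: R] (cst c%:E).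
  exact: finite_measure_integrable_cst.
have i1c (c : R) : (\int[law]_x c%:E = c%:E)%E.
  by rewrite integral_cst//= probability_setT mule1.
transitivity (\int[law]_x ((1 - a * mu)%:E + a%:E * x%:E))%E.
  by apply: eq_integral => x _; rewrite -EFinM -EFinD; congr EFin; ring.
rewrite integralD//; [|exact: i1|exact: integrableZl].
rewrite integralZl// i1c -[X in (_ * X)%E](fineK fmu).
by rewrite -/mu -EFinM -EFinD; congr EFin; ring.
Qed.

(* The centred linear term of the pointwise bound integrates to zero. *)
Lemma integral_expR_le (g : R -> R) (p a r V : R) :
  measurable_fun [set: R] g -> 0 <= r ->
  (forall x, expR (g x) <= 1 + a * (x - mu) + r * `|x - mu| `^ p) ->
  (\int[law]_x (`|x - mu| `^ p)%:E <= V%:E)%E ->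
  (\int[law]_x (expR (g x))%:E <= (1 + r * V)%:E)%E.
Proof.
move=> mg r0 gle hV.
pose phi x : \bar R := (`|x - mu| `^ p)%:E.
pose h x : \bar R := (1 + a * (x - mu))%:E.
have mphi : measurable_fun [set: R] phi.
  by apply/measurable_EFinP; exact: measurable_powR_dist.
have mh : measurable_fun [set: R] h.
  apply/measurable_EFinP; apply: measurable_funD => //.
  by apply: measurable_funM => //; exact: measurable_funB.
have ih : law.-integrable [set: R] h.
  rewrite (_ : h = (fun x => (1 - a * mu)%:E + a%:E * x%:E)%E); last first.
    by apply/funext => x; rewrite /h -EFinM -EFinD; congr EFin; ring.
  apply: integrableD => //; last exact: integrableZl.
  exact: finite_measure_integrable_cst.
have iphi : law.-integrable [set: R] phi.
  apply/integrableP; split=> //.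
  under eq_integral do rewrite gee0_abs ?lee_fin ?powR_ge0//.
  by rewrite (le_lt_trans hV)// ltry.
apply: (@le_trans _ _ (\int[law]_x (h x + r%:E * phi x))%E).
  apply: ge0_le_integral => //.
  - apply/measurable_EFinP; exact: measurableT_comp.
  - by apply: emeasurable_funD => //; exact: emeasurable_funM.
  - by move=> x _; rewrite -EFinM -EFinD lee_fin.
rewrite integralD//; last exact: integrableZl.
rewrite integral_affine integralZl// EFinD leeD2l//.
by rewrite EFinM lee_wpmul2l// lee_fin.
Qed.

End moments.

(** * Order statistics through sorting permutations *)

Section order_statistics.
Context (R : realType) (n : nat).
Implicit Types (x : 'I_n -> R) (s : 'S_n) (k : nat).

(** Sorted data are carried as a function composed with a permutation, so that ranks stay linked to
    the original indices. *)
Definition ascending x := forall i j : 'I_n, (i <= j)%N -> x i <= x j.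

Lemma order_stats_perm x :
  exists s, order_stats x = [seq x (s i) | i <- enum 'I_n].
Proof.
have /tuple_permP[s e] :
    perm_eq (order_stats x) [tuple x i | i < n] by rewrite /order_stats perm_sort.
exists s; rewrite e /=; apply: eq_map => i; exact: tnth_mktuple.
Qed.

Lemma order_stats_sorted x : sorted <=%R (order_stats x).
Proof. by apply: sort_sorted; exact: le_total. Qed.

Lemma nth_map_enum x (i : 'I_n) : nth 0 [seq x j | j <- enum 'I_n] i = x i.
Proof. by rewrite (nth_map i) ?size_enum_ord// nth_ord_enum. Qed.

Lemma ascending_perm x : exists s, ascending (x \o s).
Proof.
have [s e] := order_stats_perm x; exists s => i j ij.
rewrite -(nth_map_enum (x \o s) i) -(nth_map_enum (x \o s) j).
have -> : [seq (x \o s) i | i <- enum 'I_n] = order_stats x by rewrite e.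
apply: sorted_leq_nth => //; [exact: le_trans|exact: order_stats_sorted|..];
  by rewrite inE e size_map size_enum_ord.
Qed.

(** Ties leave the sorting permutation undetermined, but the sorted sequence is unique. *)
Lemma order_stats_ascending x s : ascending (x \o s) ->
  order_stats x = [seq x (s i) | i <- enum 'I_n].
Proof.
move=> asc; apply: (@sorted_eq _ <=%R); [exact: le_trans|exact: le_anti|
  exact: order_stats_sorted| |].
- apply/(sortedP 0) => i; rewrite size_map size_enum_ord => hi.
  have hi' : (i < n)%N by exact: ltn_trans hi.
  rewrite -/(x \o s) (nth_map_enum (x \o s) (Ordinal hi')).
  rewrite (nth_map_enum (x \o s) (Ordinal hi)); exact: asc.
- have [t ->] := order_stats_perm x.
  have p (u : {perm 'I_n}) :
      perm_eq [seq x (u i) | i <- enum 'I_n] [tuple x i | i < n].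
    by apply/tuple_permP; exists u; apply/esym/eq_map => i; exact: tnth_mktuple.
  by rewrite (perm_trans (p t))// perm_sym.
Qed.

Lemma trimmed_mean_ascending x s k : ascending (x \o s) ->
  trimmed_mean k x = (n - 2 * k)%:R^-1 *
    \sum_(i < n | (k <= i < n - k)%N) x (s i).
Proof.
move=> asc; rewrite /trimmed_mean (order_stats_ascending asc); congr (_ * _).
rewrite (big_nat_widenl _ 0)// (big_nat_widen _ _ n) ?leq_subr// big_mkord.
apply: eq_big => [i//|i _]; exact: (nth_map_enum (x \o s)).
Qed.

End order_statistics.

(** * Deterministic bound for the trimmed sum of contaminated data *)

Section trimming.
Context (R : realType) (n f c : nat) (y z : 'I_n -> R) (b M : R).
Hypotheses (b0 : 0 <= b) (M0 : 0 <= M) (asc : ascending z).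
Let k := (f + c)%N.
Let D := [set i | z i != y i]%SET.
Let I := [set i : 'I_n | (k <= i < n - k)%N]%SET.
Hypotheses (cardD : (#|D| <= f)%N)
  (card_exceed : (#|[set i | (b < `|y i|)%R]%SET| < c)%N).

Lemma card_ord_ltn m : (m <= n)%N -> #|[set i : 'I_n | (i < m)%N]%SET| = m.
Proof.
move=> mn; rewrite -sum1_card -[RHS]card_ord -sum1_card [RHS](big_ord_widen n (fun=> 1%N))//.
by apply: eq_bigl => i; rewrite finset.inE.
Qed.

Lemma card_ord_geq m : (m <= n)%N ->
  #|[set i : 'I_n | (m <= i)%N]%SET| = (n - m)%N.
Proof.
move=> mn; have := cardsC [set i : 'I_n | (i < m)%N]%SET.
rewrite card_ord_ltn// card_ord => e; apply/eqP; rewrite -(eqn_add2l m) subnKC// -[X in _ == X]e eqn_add2l.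
by apply/eqP/eq_card => i; rewrite !finset.inE -leqNgt.
Qed.

(** At most [f] indices are contaminated and fewer than [c] genuine values exceed [b], so
    [k = f + c] indices cannot all be bad. *)
Lemma card_not_all_exceed (U : {set 'I_n}) : (k <= #|U|)%N ->
  exists2 j, j \in U & `|z j| <= b.
Proof.
move=> kU; apply/exists2P/not_existsP => h.
suff : (#|U| < k)%N by rewrite ltnNge kU.
have sU : U \subset D :|: [set i | b < `|y i|]%SET.
  apply/fintype.subsetP => j jU; rewrite !finset.inE.
  have [<-|//] := eqVneq; rewrite /= ltNge; apply/negP => zb.
  exact: (h j).
apply: leq_ltn_trans (subset_leq_card sU) _.
apply: leq_ltn_trans (leq_card_setU _ _) _.
by rewrite /k; apply: leq_ltn_trans (leq_add cardD (leqnn _)) _; rewrite ltn_add2l.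
Qed.

(** At least [k] indices lie at or below [i], and at least [k] at or above it. Each side thus holds
    a value in [[-b, b]], and [z] is ascending. *)
Lemma mid_norm_le i : i \in I -> `|z i| <= b.
Proof.
rewrite finset.inE => /andP[ki ikn]; rewrite ler_norml; apply/andP; split.
- have [|j] := @card_not_all_exceed [set j : 'I_n | (j < i.+1)%N].
    by rewrite card_ord_ltn// ltnW.
  rewrite finset.inE ltnS => /asc ji; rewrite ler_norml => /andP[h _].
  exact: le_trans ji.
- have [|j] := @card_not_all_exceed [set j : 'I_n | (i <= j)%N].
    by rewrite card_ord_geq 1?ltnW//; lia.
  rewrite finset.inE => /asc ij; rewrite ler_norml => /andP[_].
  exact: le_trans.
Qed.

Lemma card_mid_compl : (#|~: I| <= k + k)%N.
Proof.
have sI : ~: I \subset [set i : 'I_n | (i < k)%N]%SET :|: [set i : 'I_n | (n - k <= i)%N]%SET.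
  by apply/fintype.subsetP => i; rewrite !finset.inE negb_and -!ltnNge ltnS.
apply: leq_trans (subset_leq_card sI) _; apply: leq_trans (leq_card_setU _ _) _.
have [kn|nk] := leqP k n.
  by rewrite card_ord_ltn// card_ord_geq ?leq_subr// subKn.
apply: leq_add; apply: leq_trans (max_card _) _; rewrite card_ord; exact: ltnW.
Qed.

(** On [I :\: D] the values are genuine and clipping leaves them alone. The full clipped sum has at
    most [2 * k + f = 3 * f + 2 * c] further terms. *)
Lemma sum_uncontaminated_mid :
  `|\sum_(i in I :\: D) z i| <= `|\sum_(i < n) clip b (y i)|
    + (3 * f + 2 * c)%:R * Num.min M b + \sum_(i < n) excess b M (y i).
Proof.
have -> : \sum_(i in I :\: D) z i = \sum_(i in I :\: D) clip b (y i).
  apply: eq_bigr => i; rewrite finset.in_setD [_ \in D]finset.inE negbK.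
  by move=> /andP[/eqP <- iI]; rewrite clip_id// mid_norm_le.
have -> : \sum_(i in I :\: D) clip b (y i) =
    \sum_(i < n) clip b (y i) - \sum_(i in ~: (I :\: D)) clip b (y i).
  rewrite [X in X - _](bigID (mem (I :\: D)))/=.
  rewrite [X in _ + X - _](eq_bigl (mem (~: (I :\: D)))) ?addrK// => i.
  by rewrite /= [in RHS]finset.in_setC.
apply: le_trans (ler_normB _ _) _; rewrite -addrA lerD2l.
have Mb0 : 0 <= Num.min M b by rewrite le_min M0.
apply: le_trans (ler_norm_sum _ _ _) _.
apply: (@le_trans _ _ (\sum_(i in ~: (I :\: D)) (Num.min M b + excess b M (y i)))).
  by apply: ler_sum => i _; exact: clip_le_excess.
rewrite big_split/= lerD//; last first.
  rewrite [leRHS](bigID (mem (~: (I :\: D))))/= lerDl.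
  by apply: sumr_ge0 => i _; exact: excess_ge0.
rewrite sumr_const -[leLHS]mulr_natl ler_wpM2r// ler_nat.
have sC : ~: (I :\: D) \subset ~: I :|: D.
  by apply/fintype.subsetP => i; rewrite !finset.inE negb_and negbK orbC.
apply: leq_trans (subset_leq_card sC) _; apply: leq_trans (leq_card_setU _ _) _.
by have := card_mid_compl; rewrite /k; lia.
Qed.

(* Each contaminated value kept in the middle is matched with a genuine one
   trimmed on the same side, which is at least as large. *)
Lemma matching_excess (V : R) (U : {set 'I_n}) :
  V <= b -> (k <= #|U|)%N -> (forall j, j \in U -> j \notin I) ->
  (forall j, j \in U -> V <= `|z j|) ->
  #|I :&: D|%:R * (V - M) <= \sum_(i < n) excess b M (y i).
Proof.
move=> Vb kU dUI hU; have [VM|MV] := leP V M.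
  apply: (@le_trans _ _ 0); first by rewrite mulr_ge0_le0// subr_le0.
  by apply: sumr_ge0 => i _; exact: excess_ge0.
(* Since [U] and [I] are disjoint, their contaminated indices together number at most
   [f <= k <= #|U|]. *)
have cU : (#|I :&: D| <= #|U :\: D|)%N.
  have : (#|(U :&: D) :|: (I :&: D)| <= f)%N.
    apply: leq_trans cardD; apply: subset_leq_card.
    by rewrite -finset.setIUl finset.subsetIr.
  rewrite cardsU (_ : (U :&: D) :&: (I :&: D) = finset.set0) ?cards0 ?subn0; last first.
    apply/eqP; rewrite -finset.subset0; apply/fintype.subsetP => j.
    rewrite !finset.in_setI => /andP[/andP[jU _] /andP[jI _]].
    by have := dUI _ jU; rewrite jI.
  move=> h; rewrite -(leq_add2l #|U :&: D|) cardsID; apply: leq_trans h _.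
  exact: leq_trans (leq_addr _ _) kU.
apply: (@le_trans _ _ (\sum_(i in U :\: D) (V - M))).
  by rewrite sumr_const -[leRHS]mulr_natl ler_wpM2r ?ler_nat// subr_ge0 ltW.
rewrite [leRHS](bigID (mem (U :\: D)))/= -[leLHS]addr0 lerD//; last first.
  by apply: sumr_ge0 => i _; exact: excess_ge0.
apply: ler_sum => i; rewrite finset.in_setD [_ \in D]finset.inE negbK.
move=> /andP[/eqP zy iU]; rewrite /excess le_max lerD2r le_min Vb andbT -zy.
by rewrite hU ?orbT.
Qed.

(** With [V] the largest [|z i|] over [I :&: D], each term is at most [M + (V - M)]. If the value
    attaining [V] is nonnegative, the top [k] values are at least [V] in absolute value; otherwise
    the bottom [k] are. *)
Lemma sum_contaminated_mid :
  \sum_(i in I :&: D) `|z i| <= f%:R * M + \sum_(i < n) excess b M (y i).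
Proof.
have W0 : 0 <= \sum_(i < n) excess b M (y i).
  by apply: sumr_ge0 => i _; exact: excess_ge0.
have [e|[i1 i1P]] := set_0Vmem (I :&: D).
  by rewrite e big_set0 addr_ge0// mulr_ge0.
have [i0 i0P hmax] := arg_maxP (fun i => `|z i|) i1P.
set V := `|z i0| in hmax.
have i0I : i0 \in I by have : i0 \in I :&: D by []; rewrite finset.in_setI => /andP[].
have Vb : V <= b by exact: mid_norm_le.
move: (i0I); rewrite finset.inE => /andP[ki ikn].
have kn : (k <= n)%N by apply: leq_trans ki (ltnW _).
have cD : (#|I :&: D| <= f)%N.
  by apply: leq_trans cardD; apply: subset_leq_card; exact: finset.subsetIr.
suff hV : #|I :&: D|%:R * (V - M) <= \sum_(i < n) excess b M (y i).
  apply: (@le_trans _ _ (\sum_(i in I :&: D) V)); first exact: ler_sum.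
  rewrite sumr_const -[leLHS]mulr_natl -[V](subrK M) mulrDr addrC lerD//.
  by rewrite ler_wpM2r// ler_nat.
have [z0|z0] := ger0P (z i0).
- apply: (@matching_excess V [set j : 'I_n | (n - k <= j)%N]%SET) => //.
  + by rewrite card_ord_geq ?leq_subr// subKn.
  + by move=> j; rewrite !finset.inE; lia.
  + move=> j; rewrite finset.inE => hj; rewrite /V (ger0_norm z0).
    apply: le_trans (ler_norm _); apply: asc.
    by rewrite ltnW// (leq_trans ikn).
- apply: (@matching_excess V [set j : 'I_n | (j < k)%N]%SET) => //.
  + by rewrite card_ord_ltn.
  + by move=> j; rewrite !finset.inE; lia.
  + move=> j; rewrite finset.inE => hj; rewrite /V (ltr0_norm z0).
    rewrite -normrN; apply: le_trans (ler_norm _); rewrite lerN2; apply: asc.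
    by rewrite ltnW// (leq_trans hj).
Qed.

(** The minimum of [M] and [b] is replaced by [M] on [3 * f] indices and by [b] on [2 * c]. The kept
    contaminated values add [f * M] and a second total excess. *)
Lemma trimmed_sum_le :
  `|\sum_(i < n | (k <= i < n - k)%N) z i| <= `|\sum_(i < n) clip b (y i)|
    + (4 * f)%:R * M + (2 * c)%:R * b + 2 * \sum_(i < n) excess b M (y i).
Proof.
rewrite (eq_bigl (mem I)); last by move=> i; rewrite /= finset.inE.
rewrite (big_setID D)/=.
apply: le_trans (ler_normD _ _) _.
have h1 := le_trans (ler_norm_sum _ _ _) sum_contaminated_mid.
have h2 := sum_uncontaminated_mid.
have m1 : Num.min M b <= M by rewrite ge_min lexx.
have m2 : Num.min M b <= b by rewrite ge_min lexx orbT.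
have : (3 * f)%:R * Num.min M b <= (3 * f)%:R * M by rewrite ler_wpM2l.
have : (2 * c)%:R * Num.min M b <= (2 * c)%:R * b by rewrite ler_wpM2l.
move: h1 h2; rewrite natrD !natrM; lra.
Qed.

End trimming.

Section trimmed_mean_deviation.
Context (R : realType) (n f c : nat) (x z : 'I_n -> R) (mu b M : R).
Hypotheses (b0 : 0 <= b) (M0 : 0 <= M) (kn : (2 * (f + c) < n)%N).
Hypotheses (card_diff : (#|[set i | z i != x i]%SET| <= f)%N)
  (card_exceed : (#|[set i | (b < `|x i - mu|)%R]%SET| < c)%N).

(** Sorting [z] and permuting [x] along with it changes neither the sums nor the cardinalities.
    Exactly [n - 2 * k] indices are kept, so [mu] can be subtracted term by term. *)
Lemma trimmed_mean_deviation :
  `|trimmed_mean (f + c) z - mu| <= (n - 2 * (f + c))%:R^-1 *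
    (`|\sum_(i < n) clip b (x i - mu)| + (4 * f)%:R * M + (2 * c)%:R * b
      + 2 * \sum_(i < n) excess b M (x i - mu)).
Proof.
set k := (f + c)%N; have kn' : (2 * k < n)%N by [].
have [s asc] := ascending_perm z.
rewrite (trimmed_mean_ascending k asc).
set m : R := (n - 2 * k)%:R; have m0 : 0 < m by rewrite ltr0n subn_gt0.
have -> : m^-1 * (\sum_(i < n | (k <= i < n - k)%N) z (s i)) - mu =
    m^-1 * \sum_(i < n | (k <= i < n - k)%N) (z (s i) - mu).
  rewrite sumrB mulrBr; congr (_ - _).
  rewrite sumr_const -[mu *+ _]mulr_natl.
  suff -> : #|[pred i : 'I_n | (k <= i < n - k)%N]| = (n - 2 * k)%N.
    by rewrite mulKf// gt_eqF.
  have -> : (n - 2 * k)%N = (\sum_(k <= i < n - k) 1)%N.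
    by rewrite sum_nat_const_nat muln1; lia.
  rewrite (big_nat_widenl _ 0)// (big_nat_widen _ _ n) ?leq_subr// big_mkord.
  by rewrite -sum1_card; apply: eq_bigl => i; rewrite unfold_in.
rewrite normrM normfV (gtr0_norm m0) ler_pM2l ?invr_gt0//.
have ascz : ascending (fun i => z (s i) - mu) by move=> i j /asc; rewrite lerD2r.
have reix (F : R -> R) : \sum_(i < n) F (x i - mu) = \sum_(i < n) F (x (s i) - mu).
  by rewrite (reindex_inj (@perm_inj _ s)).
rewrite !reix.
apply: (trimmed_sum_le b0 M0 ascz) => //.
- apply: leq_trans card_diff.
  rewrite -(card_preimset [set i | z i != x i]%SET (@perm_inj _ s)); apply: subset_leq_card.
  apply/fintype.subsetP => i; rewrite !finset.inE; apply: contraNN.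
  by move=> /eqP ->.
- apply: leq_ltn_trans card_exceed.
  rewrite -(card_preimset [set i | (b < `|x i - mu|)%R]%SET (@perm_inj _ s)); apply: subset_leq_card.
  by apply/fintype.subsetP => i; rewrite !finset.inE.
Qed.

End trimmed_mean_deviation.

(** Each of the finitely many permutations sorts the sample on a measurable set, on which the
    trimmed mean is a fixed linear combination of the variables. *)
Lemma measurable_trimmed_mean d (T : measurableType d) (R : realType) (n k : nat)
    (X : 'I_n -> T -> R) : (forall i, measurable_fun setT (X i)) ->
  measurable_fun setT (fun w => trimmed_mean k (fun i => X i w)).
Proof.
move=> mX _ Y mY; rewrite setTI.
pose L (s : {perm 'I_n}) w := (n - 2 * k)%:R^-1 *
    \sum_(i < n | (k <= i < n - k)%N) X (s i) w.
have mL s : measurable_fun setT (L s).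
  apply: measurable_funM => //.
  rewrite (_ : (fun w => _) = (fun w =>
      \sum_(i <- [seq i : 'I_n <- index_enum 'I_n | (k <= i < n - k)%N]) X (s i) w)).
    exact: measurable_sum.
  by apply/funext => w; rewrite big_filter.
rewrite (_ : _ @^-1` Y = \bigcup_(s in [set: {perm 'I_n}])
    ((\bigcap_(i in [set: 'I_n]) \bigcap_(j in [set j : 'I_n | (i <= j)%N])
      [set w | X (s i) w <= X (s j) w]) `&` (L s @^-1` Y))); last first.
  apply/seteqP; split => [w /= Yw|w [s _ [asc /= Yw]]].
    have [s asc] := ascending_perm (fun i => X i w).
    exists s => //; split; first by move=> i _ j /= ij; exact: (asc i j ij).
    by rewrite /= /L -(trimmed_mean_ascending k asc).
  have asc' : ascending ((fun i => X i w) \o s) by move=> i j ij; exact: asc.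
  by rewrite /= (trimmed_mean_ascending k asc').
apply: fin_bigcup_measurable => [|s _]; first exact: finite_finset.
apply: measurableI; last first.
  by rewrite -[X in measurable X]setTI; exact: mL.
apply: fin_bigcap_measurable => [|i _]; first exact: finite_finset.
apply: fin_bigcap_measurable => [|j _]; first exact: finite_finset.
by rewrite -[X in measurable X]setTI; exact: measurable_fun_ler.
Qed.

(** * Truncation levels *)

Section truncation_level.
Context (R : realType).
Implicit Types (v p delta : R).

(* At this level Markov's inequality gives the tail probability [delta]. *)
Definition level v p delta : R := v * delta `^ (- p^-1).

Lemma level_gt0 v p delta : 0 < v -> 0 < delta -> 0 < level v p delta.
Proof. by move=> v0 d0; rewrite mulr_gt0// powR_gt0. Qed.

Lemma powR_div_level v p delta : 0 < v -> 0 < delta -> 1 <= p ->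
  (v / level v p delta) `^ p = delta.
Proof.
move=> v0 d0 p1; have p0 : p != 0 by rewrite gt_eqF// (lt_le_trans ltr01).
rewrite /level invfM mulrA divff ?gt_eqF// mul1r powRN invrK -powRrM mulVf//.
by rewrite powRr1// ltW.
Qed.

(** This identity produces the exponent [(p - 1) / p] of the claim. *)
Lemma level_mul v p delta : 0 < delta -> 1 <= p ->
  level v p delta * delta = v * delta `^ ((p - 1) / p).
Proof.
move=> d0 p1; have p0 : p != 0 by rewrite gt_eqF// (lt_le_trans ltr01).
rewrite /level -mulrA -{2}[delta]powRr1 ?(ltW d0)// -powRD; last first.
  by rewrite (gt_eqF d0) implybT.
by congr (_ * _ `^ _); field.
Qed.

End truncation_level.

Lemma expR_ceil_ln_le (R : realType) (alpha : R) : 0 < alpha ->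
  expR (- `|Num.ceil (ln (4 / alpha))|%N%:R) <= alpha / 4.
Proof.
move=> a0; set L := ln (4 / alpha).
have h4 : 0 < 4 / alpha by rewrite divr_gt0.
apply: (@le_trans _ _ (expR (- L))); last by rewrite expRN lnK ?posrE// invf_div.
rewrite ler_expR lerN2; apply: le_trans (ceil_ge L) _.
by rewrite natr_absz ler_int ler_norm.
Qed.

(** * Concentration for fixed [p] and [q] *)

Section concentration.
Context d (T : measurableType d) (R : realType) (P : probability T R).
Context (n f c : nat) (X Xeps : 'I_n -> {RV P >-> R}) (law : probability R R).
Context (p q vp vq eps : R).
Hypotheses (indX : mutually_independent X)
  (lawX : forall i (A : set R), measurable A -> distribution P (X i) A = law A)
  (law1 : law.-integrable [set: R] EFin).
Let mu : R := fine (\int[law]_x (x%:E))%E.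
Hypotheses (p1 : 1 <= p) (q12 : 1 <= q <= 2) (vp0 : 0 < vp) (vq0 : 0 < vq)
  (moment_p : (\int[law]_x (`|x - mu| `^ p)%:E <= (vp `^ p)%:E)%E)
  (moment_q : (\int[law]_x (`|x - mu| `^ q)%:E <= (vq `^ q)%:E)%E).
Hypotheses (eps0 : 0 < eps) (c0 : (0 < c)%N) (kn : (2 * (f + c) < n)%N)
  (feps : f%:R <= eps * n%:R)
  (card_diff : forall w, (#|[set i | Xeps i w != X i w]%SET| <= f)%N).
(** The [16] exceeds the constants [15] and [8] of the exponential bounds, so [n * (15 * delta)] and
    [n * (8 * delta)] fit into the margin [c] between the threshold [2 * c] and the target
    exponent. *)
Let delta : R := c%:R / (16 * n%:R).
Let b := level vq q delta.
Let M := level vp p eps.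

Let n0 : 0 < n%:R :> R. Proof. by rewrite ltr0n (leq_ltn_trans _ kn). Qed.
Let cR0 : 0 < c%:R :> R. Proof. by rewrite ltr0n. Qed.
Let delta0 : 0 < delta. Proof. by rewrite divr_gt0// mulr_gt0. Qed.
Let b0 : 0 < b. Proof. exact: level_gt0. Qed.
Let M0 : 0 < M. Proof. exact: level_gt0. Qed.
Let n_delta : n%:R * delta = c%:R / 16.
Proof. by rewrite /delta; field; rewrite gt_eqF. Qed.

Let measurable_centred : measurable_fun [set: R] (fun x => x - mu).
Proof. exact: measurable_funB. Qed.

Let measurable_clip : measurable_fun [set: R] (fun x => clip b (x - mu)).
Proof. by apply: measurable_maxr => //; exact: measurable_minr. Qed.

Let measurable_excess : measurable_fun [set: R] (fun x => excess b M (x - mu)).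
Proof.
apply: measurable_maxr => //; apply: measurable_funB => //.
by apply: measurable_minr => //; exact: measurableT_comp.
Qed.

Let measurable_exceed : measurable_fun [set: R] (fun x => (b < `|x - mu|)%R%:R : R).
Proof.
rewrite (_ : (fun x => _) = \1_[set x | b < `|x - mu|]).
  apply: measurable_indic; rewrite -[X in measurable X]setTI.
  by apply: measurable_fun_ltr => //; exact: measurableT_comp.
apply/funext => x; rewrite indicE; congr ((nat_of_bool _)%:R).
by apply/idP/idP; rewrite inE.
Qed.

(** The term in [a] integrates to zero because [law] has mean [mu], so the moment enters only
    through the power of [v / t]. *)
Lemma chernoff_moment (g : R -> R) (a r t e v s : R) :
  measurable_fun [set: R] g -> 0 <= r -> 0 < t -> 0 < v ->
  (forall x, expR (g x) <= 1 + a * (x - mu) + r * `|(x - mu) / t| `^ e) ->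
  (\int[law]_x (`|x - mu| `^ e)%:E <= (v `^ e)%:E)%E ->
  (P [set w | (s <= \sum_(i < n) g (X i w))%R]
    <= (expR (n%:R * (r * (v / t) `^ e) - s))%:E)%E.
Proof.
move=> mg r0 t0 v0 hg hv; apply: (chernoff_iid indX lawX s mg).
have ti0 : 0 <= t^-1 by rewrite invr_ge0 ltW.
rewrite powRM ?(ltW v0)// [_ * t^-1 `^ e]mulrC mulrA.
apply: (integral_expR_le law1 mg (a := a)) hv; first by rewrite mulr_ge0 ?powR_ge0.
move=> x; apply: le_trans (hg x) _; rewrite normrM powRM// (ger0_norm ti0).
by rewrite -mulrA [`|_| `^ _ * _]mulrC.
Qed.

(** [E1] counts exceedances of [b], [E2] and [E3] are the two one-sided tails of the clipped sum,
    and [E4] is the tail of the total excess. Division by [b] makes every summand bounded by a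
    constant. *)
Let E1 : set T :=
  [set w | (2 * c)%:R <= \sum_(i < n) (2 * (b < `|X i w - mu|)%R%:R : R)].
Let E2 := [set w | (2 * c)%:R <= \sum_(i < n) clip b (X i w - mu) / b].
Let E3 := [set w | (2 * c)%:R <= \sum_(i < n) clip b (- (X i w - mu)) / b].
Let E4 := [set w | c%:R + n%:R * (3 * (M / b) * eps) <=
  \sum_(i < n) excess b M (X i w - mu) / b].

Let PE1 : (P E1 <= (expR (- c%:R))%:E)%E.
Proof.
have /andP[q1 _] := q12.
apply: (@le_trans _ _ (expR (n%:R * (15 * (vq / b) `^ q) - (2 * c)%:R))%:E).
  apply: (@chernoff_moment (fun x => 2 * (b < `|x - mu|)%R%:R) 0) => //.
    exact: measurable_funM.
  by move=> x; rewrite mul0r addr0; exact: expR_exceed_le.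
(* The exponent is [15 * c / 16 - 2 * c]. *)
rewrite lee_fin ler_expR powR_div_level// mulrCA n_delta natrM.
by have := cR0; lra.
Qed.

Let PE2 : (P E2 <= (expR (- c%:R))%:E)%E.
Proof.
have /andP[q1 _] := q12.
apply: (@le_trans _ _ (expR (n%:R * (8 * (vq / b) `^ q) - (2 * c)%:R))%:E).
  apply: (@chernoff_moment (fun x => clip b (x - mu) / b) b^-1) => //.
    exact: measurable_funM.
  by move=> x; rewrite [b^-1 * _]mulrC; exact: expR_clip_le.
rewrite lee_fin ler_expR powR_div_level// mulrCA n_delta natrM.
by have := cR0; lra.
Qed.

Let PE3 : (P E3 <= (expR (- c%:R))%:E)%E.
Proof.
have /andP[q1 _] := q12.
apply: (@le_trans _ _ (expR (n%:R * (8 * (vq / b) `^ q) - (2 * c)%:R))%:E).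
  apply: (@chernoff_moment (fun x => clip b (- (x - mu)) / b) (- b^-1)) => //.
    under eq_fun do rewrite clipN ?(ltW b0)// mulNr.
    by apply: measurable_funN; exact: measurable_funM.
  move=> x; have := expR_clip_le (- (x - mu)) b0 q12.
  by rewrite !mulNr normrN [b^-1 * _]mulrC.
rewrite lee_fin ler_expR powR_div_level// mulrCA n_delta natrM.
by have := cR0; lra.
Qed.

Let PE4 : (P E4 <= (expR (- c%:R))%:E)%E.
Proof.
apply: (@le_trans _ _ (expR (n%:R * (3 * (M / b) * (vp / M) `^ p)
   - (c%:R + n%:R * (3 * (M / b) * eps))))%:E).
  apply: (@chernoff_moment (fun x => excess b M (x - mu) / b) 0) => //.
  - exact: measurable_funM.
  - by rewrite mulr_ge0// divr_ge0// ltW.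
  - by move=> x; rewrite mul0r addr0; exact: expR_excess_le.
(* At level [M] the moment factor equals [eps], so the second part of the threshold cancels
   exactly. *)
by rewrite lee_fin ler_expR powR_div_level// opprD addrCA subrr addr0.
Qed.

Let deviation w : ~ E1 w -> ~ E2 w -> ~ E3 w -> ~ E4 w ->
  `|trimmed_mean (f + c) (fun i => Xeps i w) - mu| <=
  (n - 2 * (f + c))%:R^-1 * (6 * c%:R * b + 10 * n%:R * (M * eps)).
Proof.
rewrite /E1 /E2 /E3 /E4 /= => /negP h1 /negP h2 /negP h3 /negP h4.
rewrite -!ltNge in h1 h2 h3 h4.
have card_exceed : (#|[set i | (b < `|X i w - mu|)%R]%SET| < c)%N.
  move: h1; rewrite -mulr_sumr natrM ltr_pM2l// -natr_sum ltr_nat.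
  suff -> : #|[set i | (b < `|X i w - mu|)%R]%SET| =
    (\sum_(i < n) nat_of_bool (b < `|X i w - mu|)%R)%N by [].
  rewrite -sum1_card big_mkcond/=; apply: eq_bigr => i _.
  by rewrite finset.inE; case: (_ < _).
apply: le_trans (trimmed_mean_deviation (ltW b0) (ltW M0) kn (card_diff w) card_exceed) _.
rewrite ler_wpM2l ?invr_ge0//.
rewrite -mulr_suml ltr_pdivrMr// in h2.
have {}h3 : - \sum_(i < n) clip b (X i w - mu) < (2 * c)%:R * b.
  move: h3; rewrite -mulr_suml ltr_pdivrMr// -sumrN.
  by under eq_bigr do rewrite clipN ?(ltW b0)//.
have {}h4 : \sum_(i < n) excess b M (X i w - mu) < c%:R * b + 3 * n%:R * (M * eps).
  move: h4; rewrite -mulr_suml ltr_pdivrMr//.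
  by congr (is_true (_ < _)); field; rewrite gt_eqF.
have h5 : `|\sum_(i < n) clip b (X i w - mu)| <= (2 * c)%:R * b.
  by rewrite ler_norml; apply/andP; split; lra.
have h6 : f%:R * M <= n%:R * (M * eps).
  by rewrite [leRHS](_ : _ = eps * n%:R * M) ?ler_pM2r//; ring.
(* [6 = 2 + 2 + 2] collects the clipped sum, the [2 * c] removed values and twice the excess;
   [10 = 4 + 2 * 3]. *)
move: h5; rewrite !natrM; lra.
Qed.

Lemma trimmed_mean_concentration :
  (P [set w | ((n - 2 * (f + c))%:R^-1 * (6 * c%:R * b + 10 * n%:R * (M * eps)) <
     `|trimmed_mean (f + c) (fun i => Xeps i w) - mu|)%R]
   <= (4 * expR (- c%:R))%:E)%E.
Proof.
set B := (_^-1 * _)%R.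
have mT : measurable_fun setT
    (fun w => `|trimmed_mean (f + c) (fun i => Xeps i w) - mu|).
  apply: measurableT_comp => //; apply: measurable_funB => //.
  exact: measurable_trimmed_mean.
have mbad : measurable [set w | B < `|trimmed_mean (f + c) (fun i => Xeps i w) - mu|].
  by rewrite -[X in measurable X]setTI; exact: measurable_fun_ltr.
have mE (g : R -> R) (t : R) : measurable_fun [set: R] g ->
    measurable [set w | t <= \sum_(i < n) g (X i w)].
  move=> mg; rewrite -[X in measurable X]setTI; apply: measurable_fun_ler => //.
  by apply: measurable_sum => i; exact: measurableT_comp.
have mE1 : measurable E1.
  by apply: (mE (fun x => 2 * (b < `|x - mu|)%R%:R)); exact: measurable_funM.
have mE2 : measurable E2.
  by apply: (mE (fun x => clip b (x - mu) / b)); exact: measurable_funM.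
have mE3 : measurable E3.
  apply: (mE (fun x => clip b (- (x - mu)) / b)).
  under eq_fun do rewrite clipN ?(ltW b0)// mulNr.
  by apply: measurable_funN; exact: measurable_funM.
have mE4 : measurable E4.
  by apply: (mE (fun x => excess b M (x - mu) / b)); exact: measurable_funM.
apply: (@le_trans _ _ (P (E1 `|` E2 `|` (E3 `|` E4)))).
  apply: le_measure; rewrite ?inE//; first by do !apply: measurableU.
  move=> w /= Bw; apply: contrapT; rewrite /setU/= !not_orP => -[[h1 h2] [h3 h4]].
  by have := deviation h1 h2 h3 h4; rewrite leNgt Bw.
have -> : 4 * expR (- c%:R) = (expR (- c%:R) + expR (- c%:R))
    + (expR (- c%:R) + expR (- c%:R)) :> R by ring.
rewrite !EFinD.
apply: le_trans (measureU2 _ (measurableU _ _ mE1 mE2) (measurableU _ _ mE3 mE4)) _.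
apply: leeD; apply: le_trans (measureU2 _ _ _) _ => //; exact: leeD.
Qed.

End concentration.

(** * From approximate minimisers to the infima *)

Lemma probability_gt_le_right (d : measure_display) (T : measurableType d)
    (R : realType) (P : probability T R) (Y : T -> R) (B a : R) :
  measurable_fun setT Y ->
  (forall e, 0 < e -> (P [set w | (B + e < Y w)%R] <= a%:E)%E) ->
  (P [set w | (B < Y w)%R] <= a%:E)%E.
Proof.
move=> mY h.
have mF e : measurable [set w | e < Y w].
  by rewrite -[X in measurable X]setTI; exact: measurable_fun_ltr.
(* These events increase to the one without slack, so continuity of [P] from below transfers the
   bound. *)
pose F (m : nat) := [set w | B + m.+1%:R^-1 < Y w].
have UF : \bigcup_m F m = [set w | B < Y w].
  apply/seteqP; split => [w [m _ /= hw]|w /= hw].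
    by apply: lt_trans hw; rewrite ltrDl invr_gt0.
  have Yw0 : 0 < Y w - B by rewrite subr_gt0.
  have [m] := ltr_add_invr Yw0; rewrite add0r => hm.
  by exists m => //; rewrite /F/= -[X in X < _]addrC -ltrBrDr.
have ndF : {homo F : m k / (m <= k)%N >-> (m <= k)%O}.
  move=> m k mk; apply/subsetPset => w /=; apply: le_lt_trans.
  by rewrite lerD2l lef_pV2 ?posrE// ler_nat.
have cF := nondecreasing_cvg_mu (mu := P) (fun m => mF _)
  (bigcup_measurable (fun m _ => mF _)) ndF.
rewrite -UF -(cvg_lim _ cF)//; apply: lime_le.
  by apply/cvg_ex; eexists; exact: cF.
by apply: nearW => m; apply: h; rewrite invr_gt0.
Qed.

Section moment_infimum.
Context (R : realType) (law : probability R R) (mu : R) (D : set R) (t : R).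
Hypotheses (law1 : law.-integrable [set: R] EFin) (D1 : D 1)
  (Dge1 : forall p, D p -> 1 <= p) (t01 : 0 < t <= 1).
Let nu (p : R) : \bar R := Lnorm law p%:E (fun x => (x - mu)%:E).
Let I := ereal_inf [set (nu p * (t `^ ((p - 1) / p))%:E)%E | p in D].

(** The term at [p = 1] is the first absolute central moment, finite by integrability. *)
Lemma moment_infimum_fin_num : I \is a fin_num.
Proof.
rewrite ge0_fin_numE; last first.
  apply: le_ereal_inf_tmp => _ [p Dp <-]; rewrite mule_ge0 ?Lnorm_ge0//.
  by rewrite lee_fin powR_ge0.
apply: (@le_lt_trans _ _ (nu 1 * (t `^ ((1 - 1) / 1))%:E)%E).
  by apply: ereal_inf_lbound; exists 1.
rewrite subrr mul0r powRr0 mule1 /nu Lnorm1.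
have : law.-integrable [set: R] (fun x => (x - mu)%:E).
  under eq_fun do rewrite EFinB.
  by apply: integrableB => //; exact: finite_measure_integrable_cst.
by move=> /integrableP[].
Qed.

Lemma moment_infimum_approx (e : R) : 0 < e -> exists p v : R,
  [/\ D p, 0 < v, (\int[law]_x (`|x - mu| `^ p)%:E <= (v `^ p)%:E)%E &
     v * t `^ ((p - 1) / p) <= fine I + e].
Proof.
move=> e0; have /andP[t0 t1] := t01.
have e20 : 0 < e / 2 by rewrite divr_gt0.
have [_ [p Dp <-]] := lb_ereal_inf_adherent e20 moment_infimum_fin_num.
have p1 := Dge1 Dp; have p0 : 0 < p by exact: lt_le_trans p1.
set s := t `^ _; have s0 : 0 < s by exact: powR_gt0.
have s1 : s <= 1.
  rewrite -[leRHS](powRr0 t) ger_powR ?t0// divr_ge0 ?(ltW p0)//.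
  by rewrite subr_ge0.
move=> hlt0; have {hlt0}hlt : (nu p * s%:E < (fine I + e / 2)%:E)%E.
  by rewrite EFinD fineK// moment_infimum_fin_num.
have nu_fin : nu p \is a fin_num.
  rewrite ge0_fin_numE ?Lnorm_ge0// ltey; apply/eqP => nuoo.
  by move: hlt; rewrite nuoo gt0_mulye ?lte_fin// ltNge leey.
have v0 : 0 <= fine (nu p) by rewrite fine_ge0// Lnorm_ge0.
(* Adding [e / 2] keeps the moment bound positive even if [nu p = 0]; since [t <= 1] it costs at
   most [e / 2]. *)
exists p, (fine (nu p) + e / 2); split => //.
- by rewrite ltr_wpDl.
- have -> : (\int[law]_x (`|x - mu| `^ p)%:E = (fine (nu p) `^ p)%:E)%E.
    rewrite -poweR_EFin fineK// poweR_Lnorm ?gt_eqF//.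
  rewrite lee_fin ge0_ler_powR ?nnegrE ?addr_ge0 ?(ltW p0) ?(ltW e20)//.
  by rewrite lerDl ltW.
- move: hlt; rewrite -(fineK nu_fin) -EFinM lte_fin => hlt.
  have : e / 2 * s <= e / 2 by rewrite ler_piMr// ltW.
  by rewrite -/s mulrDl; lra.
Qed.

End moment_infimum.

(** * Integer parts and the size of the trimming *)

Section trimming_levels.
Context (R : realType).

Lemma le_absz_floor (x : R) (m : nat) : m%:R <= x -> (m <= `|Num.floor x|)%N.
Proof.
move=> mx; have m0 : (m%:Z <= Num.floor x)%R by rewrite floor_ge_int.
by rewrite -lez_nat gez0_abs// (le_trans _ m0).
Qed.

Lemma absz_floor_le (x : R) : 0 <= x -> `|Num.floor x|%N%:R <= x.
Proof.
move=> x0; rewrite natr_absz ger0_norm ?floor_ge0//; exact: floor_le.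
Qed.

(** Since [expR 1 <= 4 < 4 / alpha]. A logarithm above [1] has a ceiling below twice its value. *)
Lemma ln_four_div_gt1 (alpha : R) : 0 < alpha < 1 -> 1 < ln (4 / alpha).
Proof.
move=> /andP[a0 a1]; rewrite -[ltLHS]expRK ltr_ln ?posrE ?expR_gt0 ?divr_gt0//.
by apply: le_lt_trans (expR1_le4 R) _; rewrite ltr_pdivlMr//; lra.
Qed.

Lemma absz_ceil_bounds (x : R) : 0 <= x ->
  x <= `|Num.ceil x|%N%:R < x + 1.
Proof.
move=> x0; rewrite natr_absz ger0_norm ?ceil_ge0//; last exact: lt_le_trans x0.
by have := ceil_itv x; rewrite intrB => /andP[h ->]; rewrite -ltrBlDr.
Qed.

(** Expand the square and drop the cross term: what remains is [2 * f + 3 * c - 1], which is at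
    least [2 * (f + c)] as [c >= 1]. *)
Lemma trimming_level_lt (d : R) (n f c : nat) : d < 1 -> (0 < c)%N ->
  (Num.sqrt (2 * f%:R + 2 * c%:R - 1) + Num.sqrt c%:R) ^+ 2 <= d * n%:R ->
  2 * (f + c)%:R <= d * n%:R /\ (2 * (f + c) < n)%N.
Proof.
move=> d1 c0 h; have cR : 1 <= c%:R :> R by rewrite ler1n.
have fR : 0 <= f%:R :> R by [].
set A := 2 * f%:R + 2 * c%:R - 1 in h; have A0 : 0 <= A by rewrite /A; lra.
have h2 : 2 * (f + c)%:R <= d * n%:R.
  apply: le_trans h; rewrite sqrrD !sqr_sqrtr// natrD /A.
  have : 0 <= Num.sqrt A * Num.sqrt c%:R by rewrite mulr_ge0// sqrtr_ge0.
  by rewrite /A -mulr_natl; lra.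
split=> //; rewrite -(ltr_nat R) natrM; apply: (le_lt_trans h2).
have [n0|n0] := posnP n; last by rewrite gtr_pMl// ltr0n.
by move: h2; rewrite n0 mulr0 natrD; lra.
Qed.

End trimming_levels.
Theorem theorem1p6 (R : realType) (d : R) :
  0 < d < 1 ->
  exists C : R,
  forall (dT : measure_display) (T : measurableType dT) (P : probability T R)
    (n : nat) (X Xeps : 'I_n -> {RV P >-> R}) (law : probability R R)
    (eps alpha : R),
    (* X_1, ..., X_n i.i.d. with common law [law] *)
    mutually_independent X ->
    (forall i (A : set R), measurable A -> distribution P (X i) A = law A) ->
    (* well-defined (finite) mean mu *)
    law.-integrable setT EFin ->
    let mu : R := fine (\int[law]_x (x%:E))%E in
    (* nu_p = (E|X_1 - mu|^p)^(1/p) *)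
    let nu (p : R) : \bar R := Lnorm law p%:E (fun x => (x - mu)%:E) in
    0 < eps < 2^-1 ->
    (forall w, (#|[set i | Xeps i w != X i w]|%:R <= eps * n%:R)) ->
    0 < alpha < 1 ->
    let fl := `|Num.floor (eps * n%:R)|%N in
    let cl := `|Num.ceil (ln (4 / alpha))|%N in
    (Num.sqrt (2 * fl%:R + 2 * cl%:R - 1) + Num.sqrt cl%:R) ^+ 2 <= d * n%:R ->
    let k := (fl + cl)%N in
    (P [set w | (`|trimmed_mean k (fun i => Xeps i w) - mu|%R%:E <=
        C%:E * (ereal_inf [set nu p * (eps `^ ((p - 1) / p)%R)%:E | p in [set p : R | (1 <= p)%R]]
              + ereal_inf [set nu q * ((ln (4 / alpha) / n%:R)%R `^ ((q - 1) / q)%R)%:E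
                          | q in [set q : R | (1 <= q <= 2)%R]]))%E]
     >= (1 - alpha)%:E)%E.
Proof.
(* [96 = 6 * 16] multiplies the constant of the deviation bound by the [16] in [delta]; [1 - d]
   bounds the kept fraction of the sample from below. *)
move=> /andP[d0 d1]; exists (96 / (1 - d)).
move=> dT T P n X Xeps law eps alpha indX lawX law1 mu nu /andP[eps0 eps12].
move=> hcont alpha01 fl cl hsqrt; cbv zeta; set k := (fl + cl)%N.
have /andP[a0 a1] := alpha01.
have L1 := ln_four_div_gt1 alpha01; set L := ln (4 / alpha) in L1 *.
have L0 : 0 < L by exact: lt_trans L1.
have /andP[] := absz_ceil_bounds (ltW L0); rewrite -/cl => Lc cL.
have c0 : (0 < cl)%N by rewrite -(ltr_nat R) (lt_le_trans L0).
have [h2k kn] := trimming_level_lt d1 c0 hsqrt; rewrite -/k in h2k kn.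
have n0 : 0 < n%:R :> R by rewrite ltr0n (leq_ltn_trans _ kn).
have en0 : 0 <= eps * n%:R by rewrite mulr_ge0// ltW.
have feps : fl%:R <= eps * n%:R := absz_floor_le en0.
have card_diff w : (#|[set i | Xeps i w != X i w]%SET| <= fl)%N.
  apply: le_absz_floor; apply: le_trans (hcont w); rewrite ler_nat.
  apply: subset_leq_card; apply/fintype.subsetP => i.
  by rewrite finset.inE => ?; rewrite mem_set.
set t := L / n%:R.
(* [L <= cl <= k <= d * n / 2 < n]. *)
have t01 : 0 < t <= 1.
  rewrite divr_gt0//= ler_pdivrMr// mul1r.
  have : d * n%:R < n%:R by rewrite gtr_pMl.
  have : fl%:R >= 0 :> R by [].
  by move: h2k; rewrite /k natrD; lra.
have eps01 : 0 < eps <= 1 by apply/andP; split => //; lra.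
set S1 := (X in (ereal_inf X + _)%E); set S2 := (X in (_ + ereal_inf X)%E).
pose D1 : set R := [set p | 1 <= p]; pose D2 : set R := [set q | 1 <= q <= 2].
have D11 : D1 1 by rewrite /D1/=.
have D21 : D2 1 by rewrite /D2/=; lra.
have D1ge p : D1 p -> 1 <= p by [].
have D2ge p : D2 p -> 1 <= p by move=> /andP[].
(* Both infima are finite, so the extended real bound is the real number [B]. *)
have f1 : ereal_inf S1 \is a fin_num :=
  moment_infimum_fin_num mu eps law1 D11.
have f2 : ereal_inf S2 \is a fin_num :=
  moment_infimum_fin_num mu t law1 D21.
set B := 96 / (1 - d) * (fine (ereal_inf S1) + fine (ereal_inf S2)).
pose Y w := `|trimmed_mean k (fun i => Xeps i w) - mu|.
have mY : measurable_fun setT Y.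
  apply: measurableT_comp => //; apply: measurable_funB => //.
  exact: measurable_trimmed_mean.
have mYB e : measurable [set w | e < Y w].
  by rewrite -[X in measurable X]setTI; exact: measurable_fun_ltr.
have tail : (P [set w | (B < Y w)%R] <= alpha%:E)%E.
  apply: probability_gt_le_right => // e e0.
  (* Two errors of this size, multiplied by [96 / (1 - d)], add up to [e]. *)
  have e'0 : 0 < e * (1 - d) / 192 by rewrite divr_gt0// mulr_gt0// subr_gt0.
  have [p [v [Dp v0 mp hp]]] :=
    moment_infimum_approx mu law1 D11 D1ge eps01 e'0.
  have [q [u [Dq u0 mq hq]]] :=
    moment_infimum_approx mu law1 D21 D2ge t01 e'0.
  have := trimmed_mean_concentration indX lawX law1 Dp Dq v0 u0 mp mq eps0 c0
    kn feps card_diff.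
  set B' := (_^-1 * _)%R => conc.
  have B'B : B' <= B + e.
    pose delta := cl%:R / (16 * n%:R) : R.
    have delta0 : 0 < delta by rewrite divr_gt0 ?mulr_gt0// ltr0n.
    have q1 : 1 <= q by exact: D2ge.
    have eb : cl%:R * level u q delta = 16 * n%:R * (u * delta `^ ((q - 1) / q)).
      rewrite -level_mul// /delta; field; rewrite gt_eqF//.
    have delta_t : delta `^ ((q - 1) / q) <= t `^ ((q - 1) / q).
      have /andP[t0 _] := t01.
      apply: ge0_ler_powR; rewrite ?nnegrE ?(ltW delta0) ?(ltW t0)//.
        by rewrite divr_ge0 ?subr_ge0// (le_trans ler01).
      (* [cl < L + 1 < 2 * L] gives [delta <= t]. *)
      rewrite /delta /t ler_pdivrMr ?mulr_gt0//.
      have -> : L / n%:R * (16 * n%:R) = 16 * L by field; rewrite gt_eqF.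
      by lra.
    have nk : (1 - d) * n%:R <= (n - 2 * k)%:R.
      rewrite natrB 1?ltnW//. rewrite natrM; move: h2k; lra.
    have ndpos : 0 < (1 - d) * n%:R by rewrite mulr_gt0// subr_gt0.
    have nkpos : 0 < (n - 2 * k)%:R :> R by exact: lt_le_trans nk.
    rewrite /B' -/delta mulrC ler_pdivrMr// -mulrA eb level_mul//.
    set x := v * _ in hp *; set y' := u * _.
    have y't : y' <= u * t `^ ((q - 1) / q) by rewrite ler_pM2l.
    have x0 : 0 <= x by rewrite mulr_ge0 ?powR_ge0// ltW.
    have Be : B + e = 96 / (1 - d) *
        (fine (ereal_inf S1) + e * (1 - d) / 192
         + (fine (ereal_inf S2) + e * (1 - d) / 192)).
      by rewrite /B; field; rewrite gt_eqF// subr_gt0.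
    have y'0 : 0 <= y' by rewrite mulr_ge0 ?powR_ge0// ltW.
    have Bxy : 96 / (1 - d) * (x + y') <= B + e.
      rewrite Be ler_pM2l ?divr_gt0 ?subr_gt0// lerD//.
      exact: le_trans y't hq.
    (* Once [1 - d] cancels, [96 * n * y' + 10 * n * x] is compared with [96 * n * (x + y')]. *)
    apply: (@le_trans _ _ ((96 / (1 - d) * (x + y')) * ((1 - d) * n%:R))).
      rewrite [leRHS](_ : _ = 96 * n%:R * (x + y')); last first.
        by field; rewrite gt_eqF// subr_gt0.
      have : 0 <= n%:R * x by rewrite mulr_ge0.
      lra.
    apply: ler_pM => //; last exact: ltW.
    by rewrite mulr_ge0 ?addr_ge0// divr_ge0// subr_ge0 ltW.
  apply: (@le_trans _ _ (P [set w | (B' < Y w)%R])).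
    by apply: le_measure; rewrite ?inE// => w /=; exact: le_lt_trans.
  (* Each of the four exceptional events receives [alpha / 4]. *)
  apply: le_trans conc _; rewrite lee_fin.
  have := expR_ceil_ln_le a0; rewrite -/L -/cl; lra.
rewrite [X in P X](_ : _ = ~` [set w | (B < Y w)%R]); last first.
  apply/seteqP; split => w /=; rewrite -(fineK f1) -(fineK f2) -EFinD -EFinM
    lee_fin -/B -/(Y w) leNgt; by move/negP.
by rewrite probability_setC// EFinB leeB.
Qed.
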